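(* Let $N\ge 1$ be an integer, let $\rho_1,\dots,\rho_N\in\mathbb{R}$, and for each $n=1,\dots,N$ let $-\infty\le l_n<u_n\le+\infty$ and let $f_n$ be a real-valued function that is continuous, strictly convex and monotonically decreasing on $[l_n,u_n]$ and continuously differentiable on $(l_n,u_n)$ with $f_n'(x)<0$ for all $x\in(l_n,u_n)$ (if $f_n$ is not defined at $l_n$ and/or $u_n$, it is extended there by continuity, $f_n(l_n)=\lim_{x\to l_n^+}f_n(x)$, $f_n(u_n)=\lim_{x\to u_n^-}f_n(x)$). Assume that $\sum_{n=1}^{j}l_n\le\rho_j$ for $j=1,\dots,N$. Consider the problem $$(\mathcal P):\quad \min_{x_1,\dots,x_N}\ \sum_{n=1}^N f_n(x_n)\quad\text{subject to}\quad \sum_{n=1}^{j}x_n\le\rho_j\ \ (j=1,\dots,N),\qquad l_n\le x_n\le u_n\ \ (n=1,\dots,N).$$ Then the solutions $x_1^\star,\dots,x_N^\star$ of $(\mathcal P)$ are given by $$x_n^\star=\xi_n(\sigma_n^\star),\qquad n=1,\dots,N,$$ where the functions $\xi_n$ are those defined in the context and the quantities $\sigma_1^\star,\dots,\sigma_N^\star$ (Lagrange multipliers) are those computed by the iterative procedure Algorithm 1 described in the context.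
   Context: Functions $h_n$ and $\xi_n$. For each $n$ put $h_n(x)=-f_n'(x)$ for $x\in(l_n,u_n)$, which is positive and strictly decreasing, and set $h_n(l_n)=\lim_{x\to l_n^+}h_n(x)$ and $h_n(u_n)=\lim_{x\to u_n^-}h_n(x)$. Let $h_n^{-1}$ denote the inverse function of $h_n$ within the interval $[l_n,u_n]$. For $0\le\varsigma<+\infty$ define $$\xi_n(\varsigma)=\begin{cases}u_n & \text{if } 0\le\varsigma<h_n(u_n),\\ h_n^{-1}(\varsigma) & \text{if } h_n(u_n)\le\varsigma<h_n(l_n),\\ l_n & \text{if } h_n(l_n)\le\varsigma,\end{cases}$$ that is, $\xi_n(\varsigma)=\min\{\max\{h_n^{-1}(\varsigma),l_n\},u_n\}$. Algorithm 1. 1. Set $j=0$ and $\gamma_n=\rho_n$ for $n=1,\dots,N$. 2. While $j<N$, do the following: (i) For every $n\in\mathcal N_j=\{j+1,\dots,N\}$: if $\gamma_n<\sum_{i=j+1}^n u_i$, compute $\varsigma_n^\star$ as the solution $\varsigma\in[0,+\infty)$ of the equation $c_n(\varsigma)=\gamma_n$, where $c_n(\varsigma)=\sum_{i=j+1}^n\xi_i(\varsigma)$; if $\gamma_n\ge\sum_{i=j+1}^n u_i$, set $\varsigma_n^\star=0$. (ii) Let $\mu^\star=\max_{n\in\mathcal N_j}\varsigma_n^\star$ and $k^\star=\max\{n\in\mathcal N_j:\varsigma_n^\star=\mu^\star\}$. (iii) Set $\sigma_n^\star=\mu^\star$ for $n=j+1,\dots,k^\star$. (iv) Set $x_n^\star=\xi_n(\sigma_n^\star)$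 for $n=j+1,\dots,k^\star$. (v) Replace $\gamma_n$ by $\gamma_n-\gamma_{k^\star}$ for $n=k^\star+1,\dots,N$. (vi) Replace $j$ by $k^\star$. The procedure stops when $j=N$, at which point all $\sigma_1^\star,\dots,\sigma_N^\star$ have been assigned.
   Formalization: Proved for every completed run of Algorithm 1; its equations can lack a solution (N=1, f=-√x on [0,1], ρ=0: x=0 solves (P) but ξ(ς)=0 has no finite ς). The exact condition for a completed run to exist is proved as well. *)

(* Defs.v *)
From HB Require Import structures.
From mathcomp Require Import all_boot all_order all_algebra.
From mathcomp Require Import all_classical all_reals all_analysis.

Set Implicit Arguments.
Unset Strict Implicit.
Unset Printing Implicit Defensive.

Import Order.TTheory GRing.Theory Num.Theory.
Import numFieldNormedType.Exports.

Local Open Scope classical_set_scope.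
Local Open Scope ring_scope.
Local Open Scope ereal_scope.

(* Indices 1, ..., N are represented by 'I_N, i.e. shifted to 0, ..., N - 1. *)

(* A cost function is a map f : R -> \bar R of which only the values at the
   real points of [l, u] matter. Extended values are allowed because the
   extension by continuity of a real-valued function on ]l, u[ may be infinite
   at a finite endpoint (e.g. x |-> - ln x at l = 0). No value is needed at an
   infinite endpoint, since the decision variables are real. *)
Record cost_fun (R : realType) (l u : \bar R) (f : R -> \bar R) : Prop :=
  CostFun {
  cost_fin_num : forall x : R, l < x%:E < u -> f x \is a fin_num ;
  cost_continuous : {within [set x : R | l <= x%:E <= u], continuous f} ;
  cost_strictly_convex : forall (x y t : R),
    l <= x%:E <= u -> l <= y%:E <= u -> x <> y -> (0 < t < 1)%R ->
    f (t * x + (1 - t) * y)%R < t%:E * f x + (1 - t)%:E * f y ;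
  cost_decreasing : forall x y : R,
    l <= x%:E <= u -> l <= y%:E <= u -> (x <= y)%R -> f y <= f x ;
  cost_derivable : forall x : R, l < x%:E < u -> derivable (fine \o f) x 1%R ;
  cost_derive_continuous : forall x : R, l < x%:E < u ->
    {for x, continuous (derive1 (fine \o f))} ;
  cost_derive_lt0 : forall x : R, l < x%:E < u -> (derive1 (fine \o f) x < 0)%R }.

(* h = - f' on ]l, u[, extended to the endpoints by its one-sided limits.
   Both the endpoints and the limits may be infinite. *)
Definition neg_deriv (R : realType) (f : R -> \bar R) (x : \bar R) : \bar R :=
  (- derive1 (fine \o f) (fine x))%:E.

Definition h_fun (R : realType) (l u : \bar R) (f : R -> \bar R)
    (x : \bar R) : \bar R :=
  if x == l then lim (neg_deriv f @ within [set y | l < y] (nbhs l))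
  else if x == u then lim (neg_deriv f @ within [set y | y < u] (nbhs u))
  else neg_deriv f x.

Definition h_inv (R : realType) (l u : \bar R) (f : R -> \bar R) :
    \bar R -> \bar R :=
  'pinv_(fun=> l) [set x | l <= x <= u] (h_fun l u f).

Definition xi (R : realType) (l u : \bar R) (f : R -> \bar R)
    (s : R) : \bar R :=
  if s%:E < h_fun l u f u then u
  else if s%:E < h_fun l u f l then h_inv l u f s%:E
  else l.

Section problem.
Context (R : realType) (N : nat).
Implicit Types (l u : 'I_N -> \bar R) (f : 'I_N -> R -> \bar R).
Implicit Types (rho gamma sigma s x : 'I_N -> R).

Definition feasible l u rho x : Prop :=
  (forall j : 'I_N, (\sum_(n < N | (n <= j)%N) x n <= rho j)%R) /\
  (forall n : 'I_N, l n <= (x n)%:E <= u n).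

Definition objective f x : \bar R := \sum_(n < N) f n (x n).

Definition is_solution l u f rho x : Prop :=
  feasible l u rho x /\
  forall y : 'I_N -> R, feasible l u rho y -> objective f x <= objective f y.

(* c_n when the first j variables have already been assigned. *)
Definition c_fun l u f (j : nat) (n : 'I_N) (t : R) : \bar R :=
  \sum_(i < N | (j <= i <= n)%N) xi (l i) (u i) (f i) t.

(* s collects values computed at step (i), for the remaining indices
   j, ..., N - 1. The equation may have several solutions (then any of them
   may be chosen), or none (then the procedure is stuck). *)
Definition step_i l u f (j : nat) gamma s : Prop :=
  forall n : 'I_N, (j <= n)%N ->
    if (gamma n)%:E < \sum_(i < N | (j <= i <= n)%N) u i
    then (0 <= s n)%R /\ c_fun l u f j n (s n) = (gamma n)%:E
    else s n = 0%R.

Definition step_ii (j : nat) s (mu : R) (k : 'I_N) : Prop :=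
  [/\ (j <= k)%N, s k = mu,
      forall n : 'I_N, (j <= n)%N -> (s n <= mu)%R &
      forall n : 'I_N, (j <= n)%N -> s n = mu -> (n <= k)%N].

(* alg_loop j gamma sigma: the while loop, entered with the first j multipliers
   already assigned and with the current values gamma, can terminate having
   assigned sigma n to every n >= j. The new value of j is k.+1 because of the
   shift of indices. Step (iv), which sets x n to xi_n (sigma n), does not
   influence the loop and is left to the user of sigma. *)
Inductive alg_loop l u f : nat -> ('I_N -> R) -> ('I_N -> R) -> Prop :=
| alg_stop gamma sigma : alg_loop l u f N gamma sigma
| alg_iter (j : nat) gamma sigma s (mu : R) (k : 'I_N) :
    (j < N)%N ->
    step_i l u f j gamma s ->
    step_ii j s mu k ->
    (forall n : 'I_N, (j <= n <= k)%N -> sigma n = mu) ->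
    alg_loop l u f k.+1
      (fun n => if (k < n)%N then (gamma n - gamma k)%R else gamma n) sigma ->
    alg_loop l u f j gamma sigma.

Definition algorithm1 l u f rho sigma : Prop := alg_loop l u f 0 rho sigma.

End problem.

(* Main.v *)
(* Write h = - f'. For every real s, xi s is the point of [l, u] characterised
   by "c < xi s iff s < h c" for all c in ]l, u[; this makes xi nonincreasing
   and continuous with values in the extended reals, and makes xi s, when it is
   finite, the strict minimiser of f y + s y over [l, u].
   The loop preserves "M >= 0 and c_n M <= gamma_n for all remaining n". Taking
   for M the last value of mu, this bounds from above the solutions of the next
   equations, which then exist by the intermediate value theorem unless some c_n
   adds +oo to -oo. Since the chosen solutions need not be monotone along the
   loop, optimality is proved with the running minimum of the values of mu: it
   yields the same x, is nonincreasing, and only drops where the constraint on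
   the partial sum is tight, so that it is a Lagrange multiplier. *)

Require Import Defs.
From HB Require Import structures.
From mathcomp Require Import all_boot all_order all_algebra.
From mathcomp Require Import all_classical all_reals all_analysis.
From mathcomp Require Import zify ring lra.

Set Implicit Arguments.
Unset Strict Implicit.
Unset Printing Implicit Defensive.

Import Order.TTheory GRing.Theory Num.Theory.
Import numFieldNormedType.Exports.

Local Open Scope classical_set_scope.
Local Open Scope ring_scope.
Local Open Scope ereal_scope.

(** * Limits in order topologies, derivatives and chords *)

Lemma cvg_order {d} {T : Type} {S : orderTopologicalType d} (F : set_system T)
    {FF : Filter F} (g : T -> S) (b : S) :
  (forall a, (a < b)%O -> \forall t \near F, (a < g t)%O) ->
  (forall a, (b < a)%O -> \forall t \near F, (g t < a)%O) ->
  g @ F --> b.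
Proof.
move=> gt_b lt_b A; rewrite itv_nbhsE.
move=> [[ [[]/= r|[]] [[]/= s|[]] ]][]// _; rewrite in_itv /= ?andbT => bi iA.
- case/andP: bi => rb bs; near=> t; apply: iA => /=; rewrite in_itv /=.
  by apply/andP; split; near: t; [exact: gt_b|exact: lt_b].
- by near=> t; apply: iA => /=; rewrite in_itv /= andbT; near: t; exact: gt_b.
- by near=> t; apply: iA => /=; rewrite in_itv /=; near: t; exact: lt_b.
- by near=> t; apply: iA; rewrite /= in_itv.
Unshelve. all: by end_near. Qed.

(** Along the segment [p] from [c] to [y], the difference quotients of [g] at [0] are at most
    [v - g c] for [0 < t < 1]; the limit from the right inherits the bound. *)
Lemma derive1_le_chord (R : realType) (g : R -> R) (c y v : R) :
  derivable g c 1%R ->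
  (forall t : R, 0 < t < 1 -> g (c + t * (y - c)) <= g c + t * (v - g c))%R ->
  (g c + derive1 g c * (y - c) <= v)%R.
Proof.
move=> dg chord; pose p (t : R) : R := (c + t * (y - c))%R.
have p0 : p (0 : R)%R = c by rewrite /p mul0r addr0.
have dp : is_derive (0 : R)%R (1 : R)%R p (y - c)%R.
  rewrite /p; apply: is_derive_eq; rewrite /GRing.scale/= ?scaler0 ?add0r ?mulr1.
  ring.
have dgp : is_derive (0 : R)%R (1 : R)%R (g \o p) (derive1 g c * (y - c))%R.
  by rewrite derive1E; apply: is_derive1_comp; rewrite p0; exact: DeriveDef.
case: dgp => cv dv; rewrite -lerBrDl -dv /derive.
have cvr := cvg_dnbhs_at_right cv.
rewrite -(cvg_lim _ cvr)//; apply: limr_le; first exact: cvgP cvr.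
near=> t.
have t0 : (0 < t)%R by near: t; exact: nbhs_right_gt.
have t1 : (t < 1)%R by near: t; exact: nbhs_right_lt.
rewrite /= /shift /= addr0 p0 [(_ *: 1)%R]mulr1 [(_ *: _)%R]mulrC.
rewrite ler_pdivrMr// lerBlDl.
by rewrite [((v - g c) * _)%R]mulrC; apply: chord; rewrite t0 t1.
Unshelve. all: by end_near. Qed.

Lemma lte_real_between (R : realType) (a b : \bar R) :
  a < b -> exists c : R, a < c%:E < b.
Proof.
move: a b => [a| |] [b| |]//=.
- rewrite lte_fin => ab; exists ((a + b) / 2)%R; rewrite !lte_fin; lra.
- by move=> _; exists (a + 1)%R; rewrite lte_fin ltrDl ltr01 ltry.
- by move=> _; exists (b - 1)%R; rewrite lte_fin ltrBlDr ltrDl ltr01 ltNyr.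
- by move=> _; exists 0%R; rewrite ltry ltNyr.
Qed.

(** * A single cost function: tangents and slopes *)

Definition slope (R : realType) (f : R -> \bar R) (c : R) : R :=
  (- derive1 (fine \o f) c)%R.

Section cost.
Context (R : realType) (l u : \bar R) (f : R -> \bar R).
Context (lu : l < u) (fc : cost_fun l u f).

Lemma interior_convex (c y t : R) : l < c%:E < u -> l <= y%:E <= u ->
  (0 < t < 1)%R -> l < (t * y + (1 - t) * c)%:E < u.
Proof.
move=> /andP[lc cu] /andP[ly yu] /andP[t0 t1]; apply/andP; split.
- move: l lc ly {cu yu} => [a| |]//; rewrite ?ltNyr// !lte_fin lee_fin => ac ay.
  by nra.
- move: u cu yu {lc ly} => [a| |]//; rewrite ?ltry// !lte_fin lee_fin => ac ay.
  by nra.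
Qed.

Lemma cost_fineK (c : R) : l < c%:E < u -> (fine (f c))%:E = f c.
Proof. by move=> lcu; apply: fineK; exact: (cost_fin_num fc). Qed.

Lemma interior_itv (c : R) : l < c%:E < u -> l <= c%:E <= u.
Proof. by move=> /andP[/ltW -> /ltW ->]. Qed.

(** A value -oo at [y] would, by strict convexity, force f strictly below -oo at the midpoint of [y]
    and an interior point. *)
Lemma cost_gtNy (y : R) : l <= y%:E <= u -> -oo < f y.
Proof.
move=> lyu; have [c lcu] := lte_real_between lu.
have [->|/eqP yc] := eqVneq y c; first by rewrite -cost_fineK// ltNyr.
have half : (0 < 2^-1 :> R)%R && (2^-1 < 1 :> R)%R by apply/andP; split; lra.
have := cost_strictly_convex fc lyu (interior_itv lcu) yc half.
rewrite -(cost_fineK lcu); case: (f y) => [r| |] /=; rewrite ?ltNyr//.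
case/andP: half => half0 _.
by rewrite mulrNy gtr0_sg// mul1e addNye ltNge leNye.
Qed.

Lemma cost_tangent (c y : R) : l < c%:E < u -> l <= y%:E <= u ->
  (fine (f c) - slope f c * (y - c))%:E <= f y.
Proof.
move=> lcu lyu.
case fy : (f y) (cost_gtNy lyu) => [v| |]// _; last by rewrite leey.
rewrite lee_fin /slope mulNr opprK.
apply: (@derive1_le_chord _ (fine \o f)); first exact: (cost_derivable fc).
move=> t t01 /=; have [yc|/eqP yc] := eqVneq y c.
  by rewrite -yc fy subrr mulr0 addr0 fy /= subrr mulr0 addr0.
have := cost_strictly_convex fc lyu (interior_itv lcu) yc t01.
rewrite fy -(cost_fineK lcu) -(cost_fineK (interior_convex lcu lyu t01)).
rewrite -!EFinM -EFinD lte_fin => /ltW.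
rewrite (_ : t * y + (1 - t) * c = c + t * (y - c))%R; last by ring.
by rewrite (_ : t * v + _ = fine (f c) + t * (v - fine (f c)))%R; last by ring.
Qed.

(** Strictness comes from the midpoint of [c] and [y]: the tangent bounds f from below there, and
    strict convexity puts f there strictly below the average of [f c] and [f y]. *)
Lemma cost_tangent_lt (c y : R) : l < c%:E < u -> l <= y%:E <= u -> y <> c ->
  (fine (f c) - slope f c * (y - c))%:E < f y.
Proof.
move=> lcu lyu yc.
case fy : (f y) (cost_gtNy lyu) => [v| |]// _; last by rewrite ltry.
have half : (0 < 2^-1 :> R)%R && (2^-1 < 1 :> R)%R by apply/andP; split; lra.
have lmu := interior_convex lcu lyu half.
have := cost_strictly_convex fc lyu (interior_itv lcu) yc half.
have := cost_tangent lcu (interior_itv lmu).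
rewrite fy -(cost_fineK lcu) -(cost_fineK lmu) -!EFinM -EFinD /= lee_fin !lte_fin.
move: (fine _) (fine _) => a b; lra.
Qed.

(** The strict tangent inequalities at [c] and at [d], each evaluated at the other point, add up to
    [(slope f c - slope f d) * (d - c) > 0]. *)
Lemma slope_lt (c d : R) : l < c%:E < u -> l < d%:E < u -> (c < d)%R ->
  (slope f d < slope f c)%R.
Proof.
move=> lcu ldu cd.
have := cost_tangent_lt lcu (interior_itv ldu); rewrite -(cost_fineK ldu) lte_fin.
move=> /(_ _)/wrap[|h1]; first by move=> dc; rewrite dc ltxx in cd.
have := cost_tangent_lt ldu (interior_itv lcu); rewrite -(cost_fineK lcu) lte_fin.
move=> /(_ _)/wrap[|h2]; first by move=> dc; rewrite dc ltxx in cd.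
nra.
Qed.

Lemma slope_gt0 (c : R) : l < c%:E < u -> (0 < slope f c)%R.
Proof. by move=> lcu; rewrite oppr_gt0; exact: (cost_derive_lt0 fc). Qed.

(** * The values of h at the endpoints *)

Lemma right_nbhs_proper : ProperFilter (within [set y | l < y] (nbhs l)).
Proof.
apply: Build_ProperFilter_ex => A.
rewrite /within itv_nbhsE => -[[ [[]/= r|[]] [[]/= s|[]] ]][]// _.
all: rewrite in_itv /= ?andbT => bi iA.
- case/andP: bi => rl ls; have [c /andP[lc cs]] := lte_real_between ls.
  by exists c%:E; apply: iA => //=; rewrite in_itv /= cs (lt_trans rl).
- by exists u; apply: iA => //=; rewrite in_itv /= andbT (lt_trans bi).
- have [c /andP[lc cs]] := lte_real_between bi.
  by exists c%:E; apply: iA => //=; rewrite in_itv /= cs.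
- by exists u; apply: iA => //=; rewrite in_itv.
Qed.

Lemma left_nbhs_proper : ProperFilter (within [set y | y < u] (nbhs u)).
Proof.
apply: Build_ProperFilter_ex => A.
rewrite /within itv_nbhsE => -[[ [[]/= r|[]] [[]/= s|[]] ]][]// _.
all: rewrite in_itv /= ?andbT => bi iA.
- case/andP: bi => rl ls; have [c /andP[lc cs]] := lte_real_between rl.
  by exists c%:E; apply: iA => //=; rewrite in_itv /= lc (lt_trans cs).
- have [c /andP[lc cs]] := lte_real_between bi.
  by exists c%:E; apply: iA => //=; rewrite in_itv /= andbT.
- by exists l; apply: iA => //=; rewrite in_itv /= (lt_trans lu).
- by exists l; apply: iA => //=; rewrite in_itv.
Qed.

(** Since [neg_deriv] goes through [fine], its limit at [l] is computed on a punctured neighbourhood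
    consisting of interior reals, even when [l] is -oo. *)
Lemma right_nbhs_real (c : R) : l < c%:E < u ->
  \forall y \near within [set y | l < y] (nbhs l),
    exists2 d : R, y = d%:E & l < d%:E < u /\ (d < c)%R.
Proof.
move=> /andP[lc cu]; rewrite near_withinE.
have : nbhs l [set y | y < c%:E].
  by apply: open_nbhs_nbhs; split => //; exact: open_ereal_lt_ereal.
apply: filterS => -[d| |]//= dc ld; last by rewrite ltNge leNye in ld.
by exists d => //; rewrite ld -lte_fin (lt_trans dc).
Qed.

Lemma left_nbhs_real (c : R) : l < c%:E < u ->
  \forall y \near within [set y | y < u] (nbhs u),
    exists2 d : R, y = d%:E & l < d%:E < u /\ (c < d)%R.
Proof.
move=> /andP[lc cu]; rewrite near_withinE.
have : nbhs u [set y | c%:E < y].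
  by apply: open_nbhs_nbhs; split => //; exact: open_ereal_gt_ereal.
apply: filterS => -[d| |]//= dc ld.
  by exists d; rewrite // ld -lte_fin (lt_trans lc).
by rewrite ltNge leey in ld.
Qed.

Let slopes := [set (slope f c)%:E | c in [set c : R | l < c%:E < u]].

(** Slopes grow towards [l] by [slope_lt], so the limit exists in [\bar R] and is the supremum,
    possibly +oo. *)
Lemma h_fun_l : h_fun l u f l = ereal_sup slopes.
Proof.
rewrite /h_fun eqxx; have pF := right_nbhs_proper.
apply/cvg_lim => //; apply: cvg_order => a.
- move=> /ereal_sup_gt[_ [c lcu <-] ac].
  apply: filterS (right_nbhs_real lcu) => _ [d -> [ldu dc]].
  by apply: (lt_trans ac); rewrite lte_fin; exact: slope_lt.
- move=> sup_a; have [c lcu] := lte_real_between lu.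
  apply: filterS (right_nbhs_real lcu) => _ [d -> [ldu dc]].
  by apply: le_lt_trans sup_a; apply: ereal_sup_ubound; exists d.
Qed.

Lemma h_fun_u : h_fun l u f u = ereal_inf slopes.
Proof.
rewrite /h_fun gt_eqF// eqxx; have pF := left_nbhs_proper.
apply/cvg_lim => //; apply: cvg_order => a.
- move=> a_inf; have [c lcu] := lte_real_between lu.
  apply: filterS (left_nbhs_real lcu) => _ [d -> [ldu dc]].
  by apply: lt_le_trans a_inf _; apply: ereal_inf_lbound; exists d.
- move=> /ereal_inf_lt[_ [c lcu <-] ac].
  apply: filterS (left_nbhs_real lcu) => _ [d -> [ldu dc]].
  by apply: (lt_trans _ ac); rewrite lte_fin; exact: slope_lt.
Qed.

Lemma h_fun_interior (c : R) : l < c%:E < u -> h_fun l u f c%:E = (slope f c)%:E.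
Proof. by move=> /andP[lc cu]; rewrite /h_fun gt_eqF// lt_eqF. Qed.

Lemma slope_lt_h_fun_l (c : R) : l < c%:E < u -> (slope f c)%:E < h_fun l u f l.
Proof.
move=> lcu; have /andP[lc cu] := lcu; have [d /andP[ld dc]] := lte_real_between lc.
have ldu : l < d%:E < u by rewrite ld (lt_trans dc).
apply: (@lt_le_trans _ _ (slope f d)%:E).
  by rewrite lte_fin; apply: slope_lt => //; rewrite -lte_fin.
by rewrite h_fun_l; apply: ereal_sup_ubound; exists d.
Qed.

Lemma h_fun_u_lt_slope (c : R) : l < c%:E < u -> h_fun l u f u < (slope f c)%:E.
Proof.
move=> lcu; have /andP[lc cu] := lcu; have [d /andP[cd du]] := lte_real_between cu.
have ldu : l < d%:E < u by rewrite du (lt_trans lc).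
apply: (@le_lt_trans _ _ (slope f d)%:E).
  by rewrite h_fun_u; apply: ereal_inf_lbound; exists d.
by rewrite lte_fin; apply: slope_lt => //; rewrite -lte_fin.
Qed.

Lemma lt_h_fun_l (s : R) : s%:E < h_fun l u f l ->
  exists2 c : R, l < c%:E < u & (s < slope f c)%R.
Proof.
rewrite h_fun_l => /ereal_sup_gt[_ [c lcu <-]]; rewrite lte_fin => sc.
by exists c.
Qed.

Lemma h_fun_u_lt (s : R) : h_fun l u f u < s%:E ->
  exists2 c : R, l < c%:E < u & (slope f c < s)%R.
Proof.
rewrite h_fun_u => /ereal_inf_lt[_ [c lcu <-]]; rewrite lte_fin => sc.
by exists c.
Qed.

(** Slopes above and below [s] occur at interior points [a <= b], and continuity of the derivative
    on [a, b] gives the value [s] between them. If [s] equals h at [u], the endpoint [u] itself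
    serves. *)
Lemma h_fun_surj (s : R) : h_fun l u f u <= s%:E < h_fun l u f l ->
  exists2 x, l <= x <= u & h_fun l u f x = s%:E.
Proof.
rewrite le_eqVlt => /andP[/predU1P[us _|us sl]].
  by exists u; rewrite // lexx ltW.
have [a lau sa] := lt_h_fun_l sl; have [b lbu bs] := h_fun_u_lt us.
have ab : (a <= b)%R.
  rewrite leNgt; apply/negP => /(slope_lt lbu lau); rewrite ltNge => /negP; apply.
  by rewrite ltW// (lt_trans bs).
have lcu c : c \in `[a, b] -> l < c%:E < u.
  rewrite in_itv /= => /andP[ac cb]; apply/andP; split.
    by apply: (@lt_le_trans _ _ a%:E); [case/andP: lau|rewrite lee_fin].
  by apply: (@le_lt_trans _ _ b%:E); [rewrite lee_fin|case/andP: lbu].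
have cont : {within `[a, b], continuous (slope f)}.
  apply: continuous_in_subspaceT => c; rewrite inE /= => cab.
  apply: continuousN; exact: (cost_derive_continuous fc (lcu _ cab)).
have [|c cab <-] := @IVT R (slope f) a b s ab cont.
  by rewrite ge_min le_max (ltW bs) (ltW sa) orbT.
by exists c%:E; [exact/interior_itv/lcu|rewrite h_fun_interior// lcu].
Qed.

(** * The functions xi: characterisation, monotonicity, continuity *)

Lemma xi_spec (s : R) :
  l <= xi l u f s <= u /\
  forall c : R, l < c%:E < u -> (c%:E < xi l u f s) = (s < slope f c)%R.
Proof.
rewrite /xi; case: ifPn => [su|].
  split=> [|c lcu]; first by rewrite lexx ltW.
  case/andP: (lcu) => _ ->; rewrite -lte_fin (lt_trans su)//.
  exact: h_fun_u_lt_slope.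
rewrite -leNgt => us; case: ifPn => [sl|]; last first.
  rewrite -leNgt => ls; split=> [|c lcu]; first by rewrite lexx ltW.
  case/andP: (lcu) => /ltW; rewrite leNgt => /negbTE-> _.
  apply/esym/negbTE; rewrite -leNgt -lee_fin (le_trans _ ls)// ltW//.
  exact: slope_lt_h_fun_l.
have [|x0 lx0 hx0] := @h_fun_surj s; first by rewrite us.
(* Two facts about [h_inv] are extracted: it is a right inverse of [h_fun] at [s], and its value
   lies in [l, u]. *)
have s_img : s%:E \in h_fun l u f @` [set x | l <= x <= u].
  by rewrite inE; exists x0.
have hK : h_fun l u f (h_inv l u f s%:E) = s%:E.
  exact: (pinvK (fun=> l) s_img).
have h_in : l <= h_inv l u f s%:E <= u.
  pose A := [set x | l <= x <= u].
  have := @funS _ _ (h_fun l u f @` A) A ('pinv_(fun=> l) A (h_fun l u f)).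
  by move=> /(_ s%:E); apply; exists x0.
split=> // c lcu; move: (h_inv _ _ _ _) hK h_in => z hz /andP[lz zu].
(* The value [l] is excluded by [s < h l], whereas [u] does occur, when [s] equals h at [u]. *)
have [zl|zl] := eqVneq z l; first by move: sl; rewrite -hz zl ltxx.
have [zu'|zu'] := eqVneq z u.
  rewrite zu' -lte_fin; case/andP: (lcu) => _ ->.
  by rewrite -hz zu' h_fun_u_lt_slope.
have lzu : l < z < u by rewrite lt_neqAle eq_sym zl lz lt_neqAle zu' zu.
move: z lzu hz {lz zu zl zu'} => [z| |].
2,3: by rewrite ?ltNge ?leey ?leNye ?andbF.
move=> lzu; rewrite h_fun_interior// => -[<-]; rewrite lte_fin.
have [cz|zc|->] := ltgtP c z.
- by rewrite slope_lt.
- by apply/esym/negbTE; rewrite -leNgt ltW// slope_lt.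
- by rewrite ltxx.
Qed.

Lemma xi_itv (s : R) : l <= xi l u f s <= u.
Proof. by case: (xi_spec s). Qed.

Lemma lt_xi (s c : R) : l < c%:E < u ->
  (c%:E < xi l u f s) = (s < slope f c)%R.
Proof. by case: (xi_spec s) => _; apply. Qed.

(** [lt_xi] alone gives only a weak inequality; applying it at a point [d] strictly between [xi s]
    and [c] makes the inequality at [c] strict. *)
Lemma xi_lt (s c : R) : l < c%:E < u -> xi l u f s < c%:E -> (slope f c < s)%R.
Proof.
move=> /andP[lc cu] /lte_real_between[d /andP[xd dc]].
have ldu : l < d%:E < u.
  by rewrite (lt_trans dc)// andbT (le_lt_trans _ xd)//; case/andP: (xi_itv s).
have : (slope f d <= s)%R by rewrite leNgt -lt_xi// -leNgt ltW.
by apply: lt_le_trans; apply: slope_lt; rewrite // lc.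
Qed.

Lemma xi_antitone (s t : R) : (s <= t)%R -> xi l u f t <= xi l u f s.
Proof.
move=> st; rewrite leNgt; apply/negP => /lte_real_between[c /andP[sc ct]].
have lcu : l < c%:E < u.
  case/andP: (xi_itv s) => ls _; case/andP: (xi_itv t) => _ tu.
  by rewrite (le_lt_trans ls)// (lt_le_trans ct).
move: ct sc; rewrite lt_xi// => tc /ltW; rewrite leNgt lt_xi//.
by rewrite (le_lt_trans st).
Qed.

(** A point strictly between [xi s] and [u] would have a slope below [s <= 0], but slopes are
    positive. At [s = 0] this covers the default multiplier of step (i). *)
Lemma xi_nonpos (s : R) : (s <= 0)%R -> xi l u f s = u.
Proof.
move=> s0; case/andP: (xi_itv s) => lx; rewrite le_eqVlt => /predU1P[//|].
move=> /lte_real_between[c /andP[xc cu]].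
have lcu : l < c%:E < u by rewrite cu (le_lt_trans lx).
by have := lt_trans (slope_gt0 lcu) (xi_lt lcu xc); rewrite ltNge s0.
Qed.

Lemma h_fun_l_le (s : R) : (xi l u f s == l) = (h_fun l u f l <= s%:E).
Proof.
apply/eqP/idP => [xl|ls].
  rewrite leNgt; apply/negP => /lt_h_fun_l[c lcu].
  by rewrite -lt_xi// xl ltNge ltW//; case/andP: lcu.
(* The slope at an interior [c] lies strictly between the values of h at [u] and at [l], which
   discards the first case of [xi]. *)
have [c lcu] := lte_real_between lu; rewrite /xi.
rewrite [_ < h_fun l u f l]ltNge ls /= ltNge (le_trans _ ls)//.
exact/ltW/(lt_trans (h_fun_u_lt_slope lcu))/slope_lt_h_fun_l.
Qed.

Lemma xi_eq_u_le (s : R) : xi l u f s = u -> s%:E <= h_fun l u f u.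
Proof.
move=> xu; rewrite leNgt; apply/negP => /h_fun_u_lt[c lcu].
by apply/negP; rewrite -leNgt ltW// -lt_xi// xu; case/andP: lcu.
Qed.

Lemma lt_h_fun_u (s : R) : s%:E < h_fun l u f u -> xi l u f s = u.
Proof. by rewrite /xi => ->. Qed.

Lemma xi_eventually_lt (a : \bar R) : l < a ->
  \forall s \near +oo%R, xi l u f s < a.
Proof.
move=> la; have : l < Order.min a u by rewrite lt_min la.
move=> /lte_real_between[c /andP[lc]]; rewrite lt_min => /andP[ca cu].
near=> s; apply: le_lt_trans ca.
rewrite leNgt lt_xi ?lc// -leNgt; near: s.
exact: (nbhs_pinfty_ge (num_real _)).
Unshelve. all: by end_near. Qed.

Lemma xi_cvg_pinfty : xi l u f s @[s --> +oo%R] --> l.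
Proof.
apply: cvg_order => a; last exact: xi_eventually_lt.
by move=> al; near=> s; apply: lt_le_trans al _; case/andP: (xi_itv s).
Unshelve. all: by end_near. Qed.

(** A real strictly between [xi s] and a bound [a] can be taken interior; by [lt_xi], which side of
    it [xi t] lies on is decided by comparing [t] with its slope, an open condition at [s]. *)
Lemma xi_continuous : continuous (xi l u f).
Proof.
move=> s; case/andP: (xi_itv s) => lx xu; apply: cvg_order => a.
- move=> ax; move: lx; rewrite le_eqVlt => /predU1P[lx|lx].
    near=> t; rewrite -lx in ax; apply: lt_le_trans ax _.
    by case/andP: (xi_itv t).
  have : Order.max a l < xi l u f s by rewrite gt_max ax.
  move=> /lte_real_between[c /andP[]]; rewrite gt_max => /andP[ac lc] cx.
  have lcu : l < c%:E < u by rewrite lc (lt_le_trans cx).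
  near=> t; apply: (lt_trans ac); rewrite lt_xi//; near: t.
  by apply: lt_nbhsl; rewrite -lt_xi.
- move=> ax; move: xu; rewrite le_eqVlt => /predU1P[ux|ux].
    near=> t; rewrite ux in ax; apply: le_lt_trans ax.
    by case/andP: (xi_itv t).
  have : xi l u f s < Order.min a u by rewrite lt_min ax.
  move=> /lte_real_between[c /andP[xc]]; rewrite lt_min => /andP[ca cu].
  have lcu : l < c%:E < u by rewrite cu (le_lt_trans lx).
  near=> t; apply: le_lt_trans ca; rewrite leNgt lt_xi// -leNgt ltW//; near: t.
  by apply: lt_nbhsr; apply: xi_lt.
Unshelve. all: by end_near. Qed.

(** * The point xi s as a strict minimiser *)

Lemma cost_le_cvg (F : set_system R) {FF : ProperFilter F} (x s K : R) :
  l <= x%:E <= u -> F --> x ->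
  (\forall z \near F, l < z%:E < u /\ (fine (f z) + s * z <= K)%R) ->
  f x + (s * x)%:E <= K%:E.
Proof.
move=> lxu Fx nearF.
have cf : f @ F --> f x.
  have := cost_continuous fc; rewrite subspace_continuousP => /(_ x lxu).
  apply: cvg_trans => A; rewrite /nbhs /= /within /= => /Fx FA.
  near=> z; have [//|lzu _] := near nearF z.
  by apply: (near FA z) => //; apply: interior_itv.
have cs : (s * z)%:E @[z --> F] --> (s * x)%:E.
  by apply: cvg_EFin; [exact: nearW|apply: (cvgM (cvg_cst s) Fx)].
apply: (cvge_le _ (cvgeD _ cf cs)); last by rewrite fin_num_adde_defl.
near=> z; have [//|lzu zK] := near nearF z.
by rewrite -(cost_fineK lzu) -EFinD lee_fin.
Unshelve. all: by end_near. Qed.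

(** The function [f z + s * z] falls strictly from [y] to the midpoint [c], and weakly from [c] to
    [x]. The second part is a limit, because [x] may be an endpoint, where only continuity is
    available. *)
Lemma xi_lagrangian (s x y : R) : xi l u f s = x%:E -> l <= y%:E <= u -> y <> x ->
  f x + (s * x)%:E < f y + (s * y)%:E.
Proof.
move=> xis lyu yx; have lxu : l <= x%:E <= u by rewrite -xis xi_itv.
(* The tangent of [f z + s * z] at [c] has derivative [s - slope f c], whose sign is known from the
   side of [xi s] on which [c] lies. *)
have down (y' c : R) : l <= y'%:E <= u -> l < c%:E < u ->
    (y' < c < x)%R || (x < c < y')%R ->
    (fine (f c) + s * c)%:E < f y' + (s * y')%:E.
  move=> ly'u lcu ord; rewrite -lteBlDr// -EFinB.
  apply: lt_le_trans (cost_tangent lcu ly'u); rewrite lte_fin.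
  case/orP: ord => /andP[c1 c2].
    have : (s < slope f c)%R by rewrite -lt_xi// xis lte_fin.
    nra.
  have : (slope f c < s)%R by apply: xi_lt; rewrite // xis lte_fin.
  nra.
have btw (c : R) : (y < c < x)%R || (x < c < y)%R -> l < c%:E < u.
  case/andP: lxu => lx xu; case/andP: lyu => ly yu.
  case/orP => /andP[c1 c2].
    by rewrite (le_lt_trans ly) ?lte_fin// (lt_le_trans _ xu) ?lte_fin.
  by rewrite (le_lt_trans lx) ?lte_fin// (lt_le_trans _ yu) ?lte_fin.
pose c := ((x + y) / 2)%R; move/eqP : yx; rewrite neq_lt => /orP[yx|xy].
- have yc : (y < c)%R by rewrite /c; lra.
  have cx : (c < x)%R by rewrite /c; lra.
  have lcu : l < c%:E < u by apply: btw; rewrite yc cx.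
  apply: (@le_lt_trans _ _ (fine (f c) + s * c)%:E); last first.
    by apply: down; rewrite // yc cx.
  apply: (@cost_le_cvg (at_left x)) => //; first exact: cvg_within.
  near=> z; have zx : (z < x)%R by near: z; exact: nbhs_left_lt.
  have cz : (c < z)%R by near: z; exact: nbhs_left_gt.
  have lzu : l < z%:E < u by apply: btw; rewrite zx (lt_trans yc).
  split=> //; have := down c z (interior_itv lcu) lzu; rewrite cz zx => /(_ isT).
  by rewrite -(cost_fineK lcu) -EFinD lte_fin => /ltW.
- have yc : (c < y)%R by rewrite /c; lra.
  have cx : (x < c)%R by rewrite /c; lra.
  have lcu : l < c%:E < u by apply: btw; rewrite yc cx orbT.
  apply: (@le_lt_trans _ _ (fine (f c) + s * c)%:E); last first.
    by apply: down; rewrite // yc cx orbT.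
  apply: (@cost_le_cvg (at_right x)) => //; first exact: cvg_within.
  near=> z; have zx : (x < z)%R by near: z; exact: nbhs_right_gt.
  have cz : (z < c)%R by near: z; exact: nbhs_right_lt.
  have lzu : l < z%:E < u by apply: btw; rewrite zx (lt_trans cz yc) orbT.
  split=> //; have := down c z (interior_itv lcu) lzu; rewrite cz zx orbT => /(_ isT).
  by rewrite -(cost_fineK lcu) -EFinD lte_fin => /ltW.
Unshelve. all: by end_near. Qed.

(** The value +oo at [x] would contradict minimality against an interior point, where f is
    finite. *)
Lemma xi_fin_num (s x : R) : xi l u f s = x%:E -> f x \is a fin_num.
Proof.
move=> xis; have lxu : l <= x%:E <= u by rewrite -xis xi_itv.
have [y /andP[ly yu]] := lte_real_between lu.
have [<-|/eqP yx] := eqVneq y x; first by apply: (cost_fin_num fc); rewrite ly.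
have lyu : l <= y%:E <= u by rewrite !ltW.
have := xi_lagrangian xis lyu yx; have := cost_gtNy lxu.
by rewrite -(@cost_fineK y) ?ly//; case: (f x).
Qed.

End cost.

(** * Finite sums, real and extended *)

Lemma sum_ord_cat (V : nmodType) (N : nat) (F : 'I_N -> V) (j k n : nat) :
  (j <= k.+1)%N -> (k <= n)%N ->
  (\sum_(i < N | (j <= i <= n)%N) F i =
   \sum_(i < N | (j <= i <= k)%N) F i + \sum_(i < N | (k < i <= n)%N) F i)%R.
Proof.
move=> jk kn; rewrite (bigID (fun i : 'I_N => (i <= k)%N)) /=; congr (_ + _)%R.
all: apply: eq_bigl => i; lia.
Qed.

Lemma sum_ord_tail (V : nmodType) (N : nat) (F : 'I_N -> V) (j k : nat) :
  (j <= k.+1)%N ->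
  (\sum_(i < N | (j <= i)%N) F i =
   \sum_(i < N | (j <= i <= k)%N) F i + \sum_(i < N | (k < i)%N) F i)%R.
Proof.
move=> jk; rewrite (bigID (fun i : 'I_N => (i <= k)%N)) /=; congr (_ + _)%R.
all: apply: eq_bigl => i; lia.
Qed.

(** The common sum is finite, hence so are all terms, and the nonnegative differences [b i - a i]
    sum to 0. *)
Lemma sume_eq_le (R : realType) (I : finType) (P : pred I) (a b : I -> \bar R) :
  (forall i, P i -> a i <= b i) ->
  \sum_(i | P i) a i \is a fin_num ->
  \sum_(i | P i) a i = \sum_(i | P i) b i ->
  forall i, P i -> a i = b i.
Proof.
move=> ab fa sab; have fb : \sum_(i | P i) b i \is a fin_num by rewrite -sab.
have {}fa i : P i -> a i = (fine (a i))%:E.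
  by move=> Pi; rewrite fineK//; move: fa => /sum_fin_numP/(_ i); apply.
have {}fb i : P i -> b i = (fine (b i))%:E.
  by move=> Pi; rewrite fineK//; move: fb => /sum_fin_numP/(_ i); apply.
have : (\sum_(i | P i) (fine (b i) - fine (a i)) = 0)%R.
  rewrite sumrB; apply/eqP; rewrite subr_eq0 -eqe -!sumEFin; apply/eqP.
  by rewrite -(eq_bigr _ fa) -(eq_bigr _ fb).
move=> /psumr_eq0P sum0 i Pi; rewrite fa// fb//; congr (_%:E); apply/eqP.
rewrite eq_sym -subr_eq0; apply/eqP/sum0 => // k Pk.
by rewrite subr_ge0 -lee_fin -fa// -fb// ab.
Qed.

(** Addition on [\bar R] fails to be continuous only at opposite infinities, which the pairwise
    condition on the limits rules out. *)
Lemma cvg_sume (R : realFieldType) (T I : Type) (F : set_system T) {FF : Filter F}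
    (r : seq I) (P : pred I) (g : I -> T -> \bar R) (b : I -> \bar R) :
  {in P &, forall i k, b i +? b k} ->
  (forall i, P i -> g i @ F --> b i) ->
  \sum_(i <- r | P i) g i t @[t --> F] --> \sum_(i <- r | P i) b i.
Proof.
move=> bb gb; elim: r => [|x r IHr].
  by rewrite big_nil; under eq_fun do rewrite big_nil; exact: cvg_cst.
rewrite big_cons; under eq_fun do rewrite big_cons.
case: ifPn => [Px|//]; apply: cvgeD => //; last exact: gb.
by apply: adde_def_sum => i Pi; apply: bb.
Qed.

(** * The loop invariant and a single pass *)

Section algorithm.
Context (R : realType) (N : nat) (l u : 'I_N -> \bar R) (f : 'I_N -> R -> \bar R).
Context (lu : forall n, l n < u n) (fc : forall n, cost_fun (l n) (u n) (f n)).
Implicit Types (gamma s sigma x y : 'I_N -> R) (j : nat) (k n : 'I_N).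

Let X n (t : R) := xi (l n) (u n) (f n) t.

Let l_neqy n : l n != +oo.
Proof. by rewrite lt_eqF// (lt_le_trans (lu n))// leey. Qed.

Let u_neqNy n : u n != -oo.
Proof. by rewrite gt_eqF// (le_lt_trans _ (lu n))// leNye. Qed.

Lemma c_fun_antitone j n (s t : R) : (s <= t)%R ->
  c_fun l u f j n t <= c_fun l u f j n s.
Proof. by move=> st; apply: lee_sum => i _; exact: xi_antitone. Qed.

Lemma c_fun_le_u j n (t : R) :
  c_fun l u f j n t <= \sum_(i < N | (j <= i <= n)%N) u i.
Proof. by apply: lee_sum => i _; case/andP: (xi_itv (lu i) (fc i) t). Qed.

Lemma c_fun_nonpos j n (t : R) : (t <= 0)%R ->
  c_fun l u f j n t = \sum_(i < N | (j <= i <= n)%N) u i.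
Proof. by move=> t0; apply: eq_bigr => i _; exact: xi_nonpos. Qed.

Definition within_budget j gamma (M : R) : Prop :=
  forall n, (j <= n)%N -> c_fun l u f j n M <= (gamma n)%:E.

Definition next_budget gamma k n : R :=
  if (k < n)%N then (gamma n - gamma k)%R else gamma n.

(** The block ending at [k] spends exactly [gamma k], which is what step (v) subtracts. *)
Lemma within_budget_next j gamma (M : R) k : (j <= k)%N ->
  within_budget j gamma M -> c_fun l u f j k M = (gamma k)%:E ->
  within_budget k.+1 (next_budget gamma k) M.
Proof.
move=> jk budget ck n kn; have := budget n (leq_trans jk (ltnW kn)).
rewrite /c_fun (@sum_ord_cat _ _ _ j k n) ?(ltnW kn)// ?(leq_trans jk)//.
rewrite -!/(c_fun _ _ _ _ _ _) ck /next_budget kn EFinB leeBrDl//.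
Qed.

Section step.
Context (j : nat) (gamma s : 'I_N -> R) (mu : R) (k : 'I_N).
Context (Hi : step_i l u f j gamma s) (Hii : step_ii j s mu k).

Lemma step_ge0 n : (j <= n)%N -> (0 <= s n)%R.
Proof. by move=> jn; have := Hi jn; case: ifP => _ => [[]|->]. Qed.

Lemma step_mu_ge0 : (0 <= mu)%R.
Proof. by case: Hii => jk <- _ _; exact: step_ge0. Qed.

(** [mu] is the largest candidate and [c_fun] is antitone, so no solved equation is exceeded; in the
    other case even the sum of the [u i] fits. *)
Lemma step_within_budget : within_budget j gamma mu.
Proof.
case: Hii => jk _ s_mu _ n jn; have := Hi jn; case: ifPn => [_ [_ <-]|].
  exact/c_fun_antitone/s_mu.
by rewrite -leNgt => ug _; apply: le_trans ug; exact: c_fun_le_u.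
Qed.

(** All candidates lie in [0, mu], so they all vanish and the largest maximising index is the last
    one: the loop ends here. *)
Lemma step_last n : mu = 0%R -> (j <= n)%N -> (n <= k)%N.
Proof.
move=> mu0 jn; case: Hii => _ _ s_mu; apply => //; apply/eqP.
by rewrite eq_le s_mu//= mu0 step_ge0.
Qed.

Lemma step_tight : mu = 0%R \/ c_fun l u f j k mu = (gamma k)%:E.
Proof.
case: Hii => jk sk _ _; have := Hi jk; rewrite sk.
by case: ifPn => _ => [[_ ->]|]; [right|left].
Qed.

(** If the equation at [k] holds, its terms have a real sum. Otherwise [mu = 0], each term is [u i],
    which is not -oo, and their sum is at most [gamma k]. *)
Lemma step_fin_num (i : 'I_N) : (j <= i <= k)%N -> X i mu \is a fin_num.
Proof.
move=> jik; have [mu0|ck] := step_tight; last first.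
  have : c_fun l u f j k mu \is a fin_num by rewrite ck.
  by move=> /sum_fin_numP/(_ i); apply; rewrite ?mem_index_enum.
have jk : (j <= k)%N by case: Hii.
have : c_fun l u f j k mu < +oo.
  by apply: le_lt_trans (step_within_budget jk) _; rewrite ltry.
have Xu n : X n mu = u n by rewrite /X xi_nonpos ?mu0.
rewrite ltey /c_fun esum_eqy => [|n _]; last by rewrite -/(X n mu) Xu.
rewrite negb_exists => /forallP/(_ i); rewrite unfold_in jik /= -/(X i mu) => Xy.
by rewrite fin_numE Xy Xu u_neqNy.
Qed.

End step.

(** * Optimality of the computed point *)

(* tau is the running minimum of the multipliers, started at M. In the last
   clause e is what y has saved on the part of the budget already spent: it can
   be worth at most M per unit later on. *)
Lemma alg_loop_sound j gamma sigma : alg_loop l u f j gamma sigma ->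
  forall M, (0 <= M)%R -> within_budget j gamma M ->
  exists x tau : 'I_N -> R,
  [/\ forall n, (j <= n)%N -> X n (sigma n) = (x n)%:E /\ X n (tau n) = (x n)%:E,
      forall n, (j <= n)%N -> (\sum_(i < N | (j <= i <= n)%N) x i <= gamma n)%R &
      forall (e : R) y, (0 <= e)%R ->
        (forall n, (j <= n)%N ->
           \sum_(i < N | (j <= i <= n)%N) y i <= gamma n + e)%R ->
        (- (M * e) <= \sum_(i < N | (j <= i)%N) tau i * (x i - y i))%R].
Proof.
elim=> {j gamma sigma}
  [gamma sigma|j gamma sigma s mu k jN Hi Hii sigma_mu _ IH] M M0 budget.
  exists (fun=> 0%R), (fun=> 0%R); split => [n|n|e y e0 _].
  1, 2: by rewrite leqNgt ltn_ord.
  by rewrite big1 ?oppr_le0 ?mulr_ge0// => i _; rewrite mul0r.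
have jk : (j <= k)%N by case: Hii.
have mu0 := step_mu_ge0 Hi Hii.
have fX := step_fin_num Hi Hii.
pose m := Order.min mu M.
have m0 : (0 <= m)%R by rewrite le_min mu0.
have mM : (m <= M)%R by rewrite ge_min lexx orbT.
(* When [M < mu], the value of [c_fun] at [M] is squeezed between [gamma k], its value at [mu], and
   the bound [gamma k] from the invariant. *)
have tight : (m = 0 /\ mu = 0)%R \/ c_fun l u f j k m = (gamma k)%:E.
  rewrite /m; have [mM'|Mm] := leP mu M.
    by case: (step_tight Hi Hii) => ->; [left|right].
  right; apply/le_anti; rewrite budget//=.
  case: (step_tight Hi Hii) => [mu00|<-]; last exact/c_fun_antitone/ltW.
  by move: Mm; rewrite mu00 ltNge M0.
have mu_m : (m <= mu)%R by rewrite ge_min lexx.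
(* Equal finite sums of termwise comparable values have equal terms, so lowering [mu] to [m] leaves
   x unchanged on the block. *)
have Xm (i : 'I_N) : (j <= i <= k)%N -> X i m = X i mu.
  move=> jik; case: tight => [[-> ->]//|cm].
  have [mu00|cmu] := step_tight Hi Hii.
    by congr (X i _); apply/le_anti; rewrite mu_m mu00 m0.
  apply/esym; move: i jik.
  apply: (@sume_eq_le _ _ (fun i : 'I_N => (j <= i <= k)%N) (X^~ mu) (X^~ m));
    rewrite //.
  - by move=> n _; apply: xi_antitone.
  - by apply/sum_fin_numP => n _; exact: fX.
  - by rewrite -!/(c_fun _ _ _ _ _ _) cm.
have last n : (m = 0 /\ mu = 0)%R -> (j <= n)%N -> (n <= k)%N.
  by case=> _; exact: (step_last Hi Hii).
have budget' : within_budget j gamma m.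
  rewrite /m; have [_|_ //] := leP mu M; exact: (step_within_budget Hi Hii).
have next : within_budget k.+1 (next_budget gamma k) m.
  case: tight => [m00|cm]; last exact: (within_budget_next jk).
  by move=> n kn; have := last n m00 (leq_trans jk (ltnW kn)); rewrite leqNgt kn.
have [x' [tau' [xE feas low]]] := IH m m0 next.
pose x (n : 'I_N) : R := if (n <= k)%N then fine (X n mu) else x' n.
pose tau (n : 'I_N) : R := if (n <= k)%N then m else tau' n.
have xblock (i : 'I_N) : (j <= i <= k)%N -> X i mu = (x i)%:E.
  by move=> jik; rewrite /x; case/andP: (jik) => _ ->; rewrite fineK// fX.
have sumx n : (n <= k)%N ->
    c_fun l u f j n mu = (\sum_(i < N | (j <= i <= n)%N) x i)%:E.
  move=> nk; rewrite -sumEFin; apply: eq_bigr => i /andP[ji in'].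
  by apply: xblock; rewrite ji (leq_trans in').
have xtail (i : 'I_N) : (k < i)%N -> x i = x' i by move=> ki; rewrite /x leqNgt ki.
have sum_tight : (m = 0 /\ mu = 0)%R \/
    (\sum_(i < N | (j <= i <= k)%N) x i = gamma k)%R.
  case: tight => [|cm]; [by left|right]; apply: EFin_inj; rewrite -sumx// -cm.
  by apply: eq_bigr => i jik; rewrite -/(X i mu) -Xm.
exists x, tau; split => [n jn|n jn|e y e0 y_le].
- have [nk|kn] := leqP n k; last by rewrite xtail// /tau leqNgt kn; exact: xE.
  have jnk : (j <= n <= k)%N by rewrite jn.
  by rewrite sigma_mu// /tau nk Xm// xblock.
- have [nk|kn] := leqP n k.
    rewrite -lee_fin -sumx//; exact: (step_within_budget Hi Hii).
  case: sum_tight => [/last/(_ jn)|sx]; first by rewrite leqNgt kn.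
  rewrite (@sum_ord_cat _ _ _ j k n) ?(ltnW kn)// ?(leq_trans jk)// sx.
  rewrite -lerBrDl; have := feas n kn; rewrite kn.
  by under eq_bigr => i /andP[ki _] do rewrite -xtail//.
- pose Y := (\sum_(i < N | (j <= i <= k)%N) y i)%R.
  (* The new saving of [y] after the block: the old saving [e] plus what [y] leaves of [gamma k]. *)
  have := low (gamma k + e - Y)%R y; have := y_le k jk; rewrite -/Y => Yk.
  rewrite subr_ge0 => /(_ Yk _)/wrap[n kn|low'].
    have := y_le n (leq_trans jk (ltnW kn)).
    rewrite (@sum_ord_cat _ _ _ j k n) ?(ltnW kn)// ?(leq_trans jk)// -/Y.
    rewrite kn; lra.
  rewrite (@sum_ord_tail _ _ _ j k) ?(leq_trans jk)//.
  rewrite [X in (_ <= X + _)%R](_ : _ =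
    m * (\sum_(i < N | (j <= i <= k)%N) x i - Y))%R; last first.
    rewrite mulrBr !mulr_sumr -sumrB; apply: eq_bigr => i /andP[_ ik].
    by rewrite /tau ik mulrBr.
  rewrite [X in (_ <= _ + X)%R](_ : _ =
    \sum_(i < N | (k < i)%N) tau' i * (x' i - y i))%R; last first.
    by apply: eq_bigr => i ki; rewrite xtail// /tau leqNgt ki.
  (* Complementary slackness on the block; with it the block and the tail together are at least
     [- (m * e)]. *)
  have mx : (m * (\sum_(i < N | (j <= i <= k)%N) x i - gamma k) = 0)%R.
    by case: sum_tight => [[-> _]|->]; rewrite ?mul0r// subrr mulr0.
  have me : (m * e <= M * e)%R by apply: ler_wpM2r.
  move: low' mx me; rewrite !(mulrBr, mulrDr); lra.
Qed.

(** The inequalities of [xi_lagrangian] are summed, one of them strict, and the linear terms are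
    absorbed by the slackness hypothesis. If [y] has an infinite cost, its objective is +oo, since
    no cost is -oo. *)
Lemma objective_lt (x y tau : 'I_N -> R) :
  (forall n, X n (tau n) = (x n)%:E) ->
  (forall n, l n <= (y n)%:E <= u n) ->
  (0 <= \sum_(n < N) tau n * (x n - y n))%R ->
  y <> x -> objective f x < objective f y.
Proof.
move=> xE lyu slack yx.
have fx n : f n (x n) = (fine (f n (x n)))%:E.
  by rewrite fineK//; exact: (xi_fin_num (lu n) (fc n) (xE n)).
have [n0 /eqP yx0] : exists n0, y n0 <> x n0.
  by apply/existsNP => yx'; apply: yx; apply/funext.
rewrite /objective (eq_bigr _ (fun n _ => fx n)) sumEFin.
have [/forallP fy|] := boolP [forall n, f n (y n) \is a fin_num]; last first.
  rewrite negb_forall => /existsP[n fyn].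
  suff -> : \sum_(n < N) f n (y n) = +oo by rewrite ltry.
  apply/eqP; rewrite esum_eqy => [|i _]; last first.
    by rewrite gt_eqF//; exact: (cost_gtNy (lu i) (fc i) (lyu i)).
  apply/existsP; exists n; rewrite unfold_in /=; move: fyn.
  rewrite fin_numE negb_and !negbK => /orP[/eqP fN|//].
  by have := cost_gtNy (lu n) (fc n) (lyu n); rewrite fN ltxx.
have {}fy n : f n (y n) = (fine (f n (y n)))%:E by rewrite fineK.
rewrite (eq_bigr _ (fun n _ => fy n)) sumEFin lte_fin -subr_gt0.
have lag n : y n <> x n ->
    (0 < fine (f n (y n)) - fine (f n (x n)) - tau n * (x n - y n))%R.
  move=> yxn; have := xi_lagrangian (lu n) (fc n) (xE n) (lyu n) yxn.
  by rewrite fx fy -!EFinD lte_fin; lra.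
have lag_ge0 n : (0 <= fine (f n (y n)) - fine (f n (x n)) - tau n * (x n - y n))%R.
  have [->|/eqP yxn] := eqVneq (y n) (x n); first by rewrite !subrr mulr0 subr0.
  exact/ltW/lag.
apply: (le_lt_trans slack); rewrite -sumrB -subr_gt0 -sumrB (bigD1 n0)//=.
by apply: ltr_pwDl; [apply: lag; exact/eqP|exact: sumr_ge0].
Qed.

(** * What the first pass of a terminating run implies *)

Lemma algorithm1_first_step (rho sigma : 'I_N -> R) : (0 < N)%N ->
  algorithm1 l u f rho sigma ->
  exists s mu k, step_i l u f 0 rho s /\ step_ii 0 s mu k.
Proof.
move=> N_gt0 loop; inversion loop as [? ? N0|? ? ? s mu k _ Hi Hii].
  by rewrite N0 ltnn in N_gt0.
by exists s, mu, k.
Qed.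

Lemma algorithm1_sound (rho sigma : 'I_N -> R) : (0 < N)%N ->
  algorithm1 l u f rho sigma ->
  exists x : 'I_N -> R, (forall n, (x n)%:E = X n (sigma n)) /\
    (forall y, is_solution l u f rho y <-> y = x).
Proof.
move=> N_gt0 loop.
have [s [mu [k [Hi Hii]]]] := algorithm1_first_step N_gt0 loop.
have [x [tau [xE feas low]]] := alg_loop_sound loop (step_mu_ge0 Hi Hii)
  (step_within_budget Hi Hii).
have best y : feasible l u rho y -> y <> x -> objective f x < objective f y.
  move=> [y_rho lyu]; apply: (@objective_lt _ _ tau) lyu _ => [n|].
    by case: (xE n).
  (* Nothing has been spent at entry, hence the saving [e = 0]. *)
  have := low 0%R y (lexx _); rewrite mulr0 oppr0; apply => n _.
  by rewrite addr0; exact: y_rho.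
have feas_x : feasible l u rho x.
  split=> n; first exact: feas.
  by have [// | <- _] := xE n; exact: xi_itv.
exists x; split=> [n|y]; first by case: (xE n).
split=> [[feas_y opt_y]|->].
  apply: contrapT => yx; have := best y feas_y yx.
  by apply/negP; rewrite -leNgt opt_y.
split=> // z feas_z; have [->//|zx] := pselect (z = x).
exact/ltW/best.
Qed.

(** If the inequality failed, any [s] would be below h at [u i], making the i-th term +oo, or at
    least h at [l k], making the k-th term -oo; but the equation at the larger of [i] and [k] has a
    real sum. *)
Lemma algorithm1_separated (rho sigma : 'I_N -> R) : (0 < N)%N ->
  algorithm1 l u f rho sigma ->
  forall i k, u i = +oo -> l k = -oo ->
    h_fun (l i) (u i) (f i) (u i) < h_fun (l k) (u k) (f k) (l k).
Proof.
move=> N_gt0 loop i k ui lk.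
have [s [mu [k' [Hi _]]]] := algorithm1_first_step N_gt0 loop.
pose n := if (i <= k)%N then k else i.
have i_n : (i <= n)%N by rewrite /n; case: (leqP i k).
have k_n : (k <= n)%N by rewrite /n; case: (leqP i k) => [//|/ltnW].
have sum_u : \sum_(i < N | (0 <= i <= n)%N) u i = +oo.
  apply/eqP; rewrite esum_eqy//; apply/existsP; exists i.
  by rewrite unfold_in /= i_n ui eqxx.
have := Hi n (leq0n n); rewrite sum_u ltry => -[_ cn].
have fX (m : 'I_N) : (m <= n)%N -> X m (s n) \is a fin_num.
  move=> mn; have : c_fun l u f 0 n (s n) \is a fin_num by rewrite cn.
  by move=> /sum_fin_numP/(_ m); apply; rewrite ?mem_index_enum.
rewrite ltNge; apply/negP => h_le.
have [sl|ls] := ltP (s n)%:E (h_fun (l k) (u k) (f k) (l k)).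
  by have := fX i i_n; rewrite /X lt_h_fun_u ?ui// -ui (lt_le_trans sl).
move: ls; rewrite -h_fun_l_le// => /eqP Xk.
by have := fX k k_n; rewrite /X Xk lk.
Qed.

(** If the [l i] already exhaust [rho n], a solution of the equation has every xi equal to its
    [l i], so it bounds h at [l i] from above. The case without an equation would force
    [l i = u i]. *)
Lemma algorithm1_slack (rho sigma : 'I_N -> R) : (0 < N)%N ->
  algorithm1 l u f rho sigma ->
  (forall n, \sum_(i < N | (i <= n)%N) l i <= (rho n)%:E) ->
  forall n, \sum_(i < N | (i <= n)%N) l i < (rho n)%:E \/
    (forall i : 'I_N, (i <= n)%N -> h_fun (l i) (u i) (f i) (l i) < +oo).
Proof.
move=> N_gt0 loop l_le n.
have [s [mu [k [Hi _]]]] := algorithm1_first_step N_gt0 loop.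
have := l_le n; rewrite le_eqVlt => /predU1P[lrho|]; [right|by left].
have fl : \sum_(i < N | (i <= n)%N) l i \is a fin_num by rewrite lrho.
have := Hi n (leq0n n); case: ifPn => [_ [_ cn] i i_n|].
  have Xl : l i = X i (s n).
    move: i i_n; apply: (sume_eq_le _ fl) => [i _|].
      by case/andP: (xi_itv (lu i) (fc i) (s n)).
    by rewrite lrho -cn.
  have : h_fun (l i) (u i) (f i) (l i) <= (s n)%:E.
    by rewrite -h_fun_l_le//; apply/eqP.
  by move=> /le_lt_trans; apply; rewrite ltry.
rewrite -leNgt => u_rho _.
have /(_ n (leqnn n)) : forall i : 'I_N, (i <= n)%N -> l i = u i.
  apply: (sume_eq_le _ fl) => [i _|]; first exact/ltW.
  apply/le_anti/andP; split; last by rewrite lrho.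
  by apply: lee_sum => i _; exact/ltW.
by move=> lu_n; have := lu n; rewrite lu_n ltxx.
Qed.

(** * Existence of a run *)

(** As [t] tends to +oo, [c_fun] tends to the sum of the [l i]. It drops below a strictly larger
    budget eventually; when h is finite at every [l i], it even reaches that sum. *)
Lemma first_budget gamma :
  (forall n, \sum_(i < N | (i <= n)%N) l i <= (gamma n)%:E) ->
  (forall n, \sum_(i < N | (i <= n)%N) l i < (gamma n)%:E \/
    (forall i : 'I_N, (i <= n)%N -> h_fun (l i) (u i) (f i) (l i) < +oo)) ->
  exists2 M : R, (0 <= M)%R & within_budget 0 gamma M.
Proof.
move=> l_le l_lt.
have : \forall t \near +oo%R, forall n, c_fun l u f 0 n t <= (gamma n)%:E.
  apply: filter_forall => n; case: (l_lt n) => [lg|h_fin].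
    have cvgl : c_fun l u f 0 n t @[t --> +oo%R] --> \sum_(i < N | (i <= n)%N) l i.
      apply: cvg_sume => [i k _ _|i _]; last exact: xi_cvg_pinfty.
      by rewrite /adde_def !(negbTE (l_neqy _)) andbF.
    have c_lt : \forall t \near +oo%R, c_fun l u f 0 n t < (gamma n)%:E.
      exact: cvgl (open_ereal_lt' lg).
    by apply: filterS c_lt => t /ltW.
  have : \forall t \near +oo%R, forall i : 'I_N, (i <= n)%N -> X i t = l i.
    apply: filter_forall => i; have [i_n|ni] := leqP i n; last exact: nearW.
    have := h_fin i i_n.
    case: h_fun (@h_fun_l_le _ _ _ _ (lu i) (fc i)) => [h hE _|//|hE _].
      near=> t => _; apply/eqP; rewrite hE lee_fin; near: t.
      exact: (nbhs_pinfty_ge (num_real _)).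
    by apply: nearW => t _; apply/eqP; rewrite hE leNye.
  apply: filterS => t Xl; apply: le_trans (l_le n).
  by rewrite le_eqVlt; apply/predU1P; left; apply: eq_bigr => i /andP[_ /Xl].
move=> budget; near (+oo%R : set_system R) => M; exists M.
  by near: M; exact: (nbhs_pinfty_ge (num_real _)).
by move=> n _; move: n; near: M.
Unshelve. all: by end_near. Qed.

Context (separated : forall i k, u i = +oo -> l k = -oo ->
  h_fun (l i) (u i) (f i) (u i) < h_fun (l k) (u k) (f k) (l k)).

(** Opposite infinities at a common [t] would give h at [l k] at most [t], and [t] at most h at
    [u i], against [separated]. *)
Lemma adde_def_xi i k (t : R) : X i t +? X k t.
Proof.
have opp i' k' : X i' t = +oo -> X k' t = -oo -> False.
  move=> Xi Xk.
  have ui : u i' = +oo.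
    by apply/eqP; rewrite -leye_eq -Xi; case/andP: (xi_itv (lu i') (fc i') t).
  have lk : l k' = -oo.
    by apply/eqP; rewrite -leeNy_eq -Xk; case/andP: (xi_itv (lu k') (fc k') t).
  have := separated ui lk; apply/negP; rewrite -leNgt.
  apply: (@le_trans _ _ t%:E).
    by rewrite -h_fun_l_le// -/(X k' t) Xk lk.
  by apply: xi_eq_u_le => //; rewrite -/(X i' t) Xi ui.
rewrite /adde_def; apply/andP; split; apply/negP => /andP[/eqP Xi /eqP Xk].
  exact: (opp i k).
exact: (opp k i).
Qed.

Lemma c_fun_continuous j n : continuous (c_fun l u f j n).
Proof.
move=> t; apply: cvg_sume => [i k _ _|i _]; first exact: adde_def_xi.
exact: xi_continuous.
Qed.

(** The solution is the supremum of the set [S] where [c_fun] exceeds [gamma n]: it contains 0 and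
    is bounded by [M]. Continuity from the right and from the left gives the two inequalities. *)
Lemma c_fun_surj j gamma n (M : R) : (0 <= M)%R ->
  c_fun l u f j n M <= (gamma n)%:E ->
  (gamma n)%:E < \sum_(i < N | (j <= i <= n)%N) u i ->
  exists2 t : R, (0 <= t)%R & c_fun l u f j n t = (gamma n)%:E.
Proof.
move=> M0 cM gu; pose S := [set t : R | (gamma n)%:E < c_fun l u f j n t].
have S0 : S 0%R by rewrite /S /= c_fun_nonpos.
have ubS : ubound S M.
  move=> t; rewrite /S /= => gt; rewrite leNgt; apply/negP => Mt.
  by move: gt; rewrite ltNge (le_trans _ cM)// c_fun_antitone// ltW.
have supS : has_sup S by split; [exists 0%R|exists M].
exists (sup S); first exact: (ub_le_sup supS.2).
have cS := @c_fun_continuous j n (sup S).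
apply/le_anti/andP; split.
  apply: (cvge_le _ (cvg_at_right_filter cS)); near=> t.
  rewrite leNgt; apply/negP => gt; have := ub_le_sup supS.2 gt.
  by rewrite leNgt => /negP; apply; near: t; exact: nbhs_right_gt.
apply: (cvge_ge _ (cvg_at_left_filter cS)); near=> t.
have : (t < sup S)%R by near: t; exact: nbhs_left_lt.
move=> /(sup_gt supS.1)[t' St' tt']; apply: (le_trans (ltW St')).
exact/c_fun_antitone/ltW.
Unshelve. all: by end_near. Qed.

(** [alg_loop] constrains [sigma] only from [j] on; prescribing the earlier entries by [sigma0] lets
    the induction keep the values of finished blocks. *)
Lemma alg_loop_exists j gamma (M : R) : (j <= N)%N -> (0 <= M)%R ->
  within_budget j gamma M ->
  forall sigma0, exists2 sigma, alg_loop l u f j gamma sigma &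
    forall n, (n < j)%N -> sigma n = sigma0 n.
Proof.
have [d] := ubnP (N - j); elim: d => // d IH in j gamma M *.
move=> djN jN M0 budget sigma0; move: jN; rewrite leq_eqVlt => /predU1P[->|jN].
  by exists sigma0 => //; exact: alg_stop.
have /boolp.choice[s sE] : forall n, exists t : R, (j <= n)%N ->
    if (gamma n)%:E < \sum_(i < N | (j <= i <= n)%N) u i
    then (0 <= t)%R /\ c_fun l u f j n t = (gamma n)%:E
    else t = 0%R.
  move=> n.
  have [jn|nj] := leqP j n; last by exists 0%R.
  have [gu|gu] := boolP ((gamma n)%:E < \sum_(i < N | (j <= i <= n)%N) u i);
    last by exists 0%R.
  by have [t t0 ct] := c_fun_surj M0 (budget n jn) gu; exists t.
(* First some maximiser [k0] of [s], then the largest index [k] with the same value. *)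
have [k0 jk0 k0max] :=
  @arg_maxP _ _ _ (Ordinal jN) (fun i : 'I_N => (j <= i)%N) s (leqnn j).
have k0P : (j <= k0)%N && (s k0 == s k0) by rewrite jk0 eqxx.
have [k /andP[jk /eqP sk] kmax] :=
  @arg_maxnP _ k0 (fun i : 'I_N => (j <= i)%N && (s i == s k0)) (@nat_of_ord N) k0P.
have Hii : step_ii j s (s k0) k.
  split=> // n jn sn.
  by apply: kmax; rewrite jn sn eqxx.
have mu0 := step_mu_ge0 sE Hii.
have budget' := step_within_budget sE Hii.
(* The 0 beyond [k] is a placeholder: only entries up to [k] are passed on as prescribed. *)
pose sigma1 n :=
  if (n <= k)%N then (if (n < j)%N then sigma0 n else s k0) else 0%R.
have [] := IH k.+1 (next_budget gamma k) (s k0) _ _ mu0 _ sigma1.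
- by move: djN jN jk (ltn_ord k); clear; lia.
- exact: ltn_ord.
- have [mu00|ck] := step_tight sE Hii; last exact: within_budget_next ck.
  move=> n kn; have := step_last sE Hii mu00 (leq_trans jk (ltnW kn)).
  by rewrite leqNgt kn.
move=> sigma loop sigmaE; exists sigma.
  apply: (alg_iter jN sE Hii) loop => n /andP[jn nk].
  by rewrite sigmaE// /sigma1 nk ltnNge jn.
move=> n nj; have nk : (n <= k)%N by rewrite ltnW// (leq_trans nj).
by rewrite sigmaE// /sigma1 nk nj.
Qed.

End algorithm.

Theorem theorem1 (R : realType) (N : nat) (N_ge1 : (1 <= N)%N)
    (rho : 'I_N -> R) (l u : 'I_N -> \bar R) (f : 'I_N -> R -> \bar R)
    (l_lt_u : forall n : 'I_N, l n < u n)
    (f_cost : forall n : 'I_N, cost_fun (l n) (u n) (f n))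
    (l_le_rho : forall j : 'I_N, \sum_(n < N | (n <= j)%N) l n <= (rho j)%:E) :
  (* the multipliers produced by the algorithm give the solutions *)
  (forall sigma : 'I_N -> R, algorithm1 l u f rho sigma ->
     exists x : 'I_N -> R,
       (forall n : 'I_N, (x n)%:E = xi (l n) (u n) (f n) (sigma n)) /\
       (forall y : 'I_N -> R, is_solution l u f rho y <-> y = x)) /\
  (* exact condition under which the equations of the algorithm are solvable *)
  ((exists sigma : 'I_N -> R, algorithm1 l u f rho sigma) <->
     (forall n : 'I_N,
        \sum_(i < N | (i <= n)%N) l i < (rho n)%:E \/
        (forall i : 'I_N, (i <= n)%N ->
           h_fun (l i) (u i) (f i) (l i) < +oo)) /\
     (forall i k : 'I_N, u i = +oo -> l k = -oo ->
        h_fun (l i) (u i) (f i) (u i) < h_fun (l k) (u k) (f k) (l k))).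
Proof.
split=> [sigma|]; first exact: algorithm1_sound.
split=> [[sigma loop]|[slack separated]].
  by split; [exact: algorithm1_slack loop _|exact: algorithm1_separated loop].
have [M M0 budget] := first_budget l_lt_u f_cost l_le_rho slack.
have [sigma loop _] :=
  alg_loop_exists l_lt_u f_cost separated (leq0n N) M0 budget (fun=> 0%R).
by exists sigma.
Qed.
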